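(* Let $(X,d)$ be a generalized strong b-metric space with canonical decomposition $X=\bigcup_{i\in I}X_i$, and put $d_i=d|_{X_i\times X_i}$. For every $i\in I$ let $(Y_i,D_i)$ be a strong b-metric space which is a completion of the strong b-metric space $(X_i,d_i)$, with corresponding isometric embedding $T_i:(X_i,d_i)\to(Y_i,D_i)$ such that $T_i(X_i)$ is $D_i$-dense in $Y_i$, where the sets $Y_i$, $i\in I$, are pairwise disjoint. Put $Y=\bigcup_{i\in I}Y_i$, define $D:Y\times Y\to[0,\infty]$ by $D(x,y)=D_i(x,y)$ if $x,y\in Y_i$ for some $i\in I$, and $D(x,y)=+\infty$ if $x\in Y_i$, $y\in Y_j$ with $i\neq j$, and define $T:X\to Y$ by $T(x)=T_i(x)$, where $i$ is the unique element of $I$ with $x\in X_i$. Then: (i) $(Y,D)$ is a complete generalized strong b-metric space; (ii) $T:(X,d)\to(Y,D)$ is an isometric embedding with $T(X)$ $D$-dense in $Y$; (iii) any other complete generalized strong b-metric space $(Z,\varrho)$ that contains a $\varrho$-dense isometric copy of $(X,d)$ (i.e. for which there is an isometric embedding $S:(X,d)\to(Z,\varrho)$ with $S(X)$ $\varrho$-dense in $Z$) is isometric to $(Y,D)$.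
   Context: A strong b-metric on a nonempty set $X$ is a function $d:X\times X\to[0,\infty)$ for which there is a number $s\ge 1$ such that for all $x,y,z\in X$: $d(x,y)=0\iff x=y$; $d(x,y)=d(y,x)$; and $d(x,y)\le d(x,z)+s\,d(y,z)$. A generalized strong b-metric is a function $d:X\times X\to[0,\infty]$ (the value $+\infty$ being allowed) satisfying the same conditions for some fixed $s\ge1$. Topology: a subset $G$ of $X$ is open if for every $x\in G$ there is $r>0$ with $B(x,r)=\{y\in X: d(x,y)<r\}\subseteq G$; density refers to this topology. A sequence $(x_n)$ converges to $x$ if $d(x_n,x)\to0$; it is Cauchy if $\lim_{m,n\to\infty}d(x_n,x_m)=0$; the space is complete if every Cauchy sequence converges to some point of it. An isometric embedding $f:(X_1,d_1)\to(X_2,d_2)$ is a map with $d_2(f(x),f(y))=d_1(x,y)$ for all $x,y\in X_1$; two spaces are isometric if there is a surjective isometric embedding of one onto the other. A completion of a strong b-metric space $(X,d)$ is a complete strong b-metric space $(Y,\rho)$ together with an isometric embedding $j:X\to Y$ with $j(X)$ dense in $Y$ (it is known that every strong b-metric space has a completion, unique up to isometry). Canonical decomposition: for a generalized strong b-metric space $(X,d)$, the relation $x\sim y\iff d(x,y)<+\infty$ is an equivalence relation; its equivalence classes $X_i$, $i\in I$, form the canonical decomposition of $X$, and each $(X_i,d|_{X_i\times X_i})$ is a strong b-metric space. *)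

(* Defs.v *)
From HB Require Import structures.
From mathcomp Require Import all_boot all_order all_algebra.
From mathcomp Require Import all_classical all_reals all_analysis.

Set Implicit Arguments.
Unset Strict Implicit.
Unset Printing Implicit Defensive.

Import Order.TTheory GRing.Theory Num.Theory.
Import numFieldNormedType.Exports.

Local Open Scope classical_set_scope.
Local Open Scope ring_scope.

(* A space is a set [A] of elements of an ambient type [T], with a distance
   [d : T -> T -> \bar R] of which only the values on [A] matter; a subspace of
   [(A, d)] is then [(B, d)] with [B `<=` A].  Likewise, a map from a space
   [A1] to a space [A2] is a function between the ambient types, of which only
   the values on [A1] matter. *)

Definition gen_strong_b_metric (R : realType) (T : Type)
    (A : set T) (d : T -> T -> \bar R) : Prop :=
  [/\ A !=set0,
      forall x y, A x -> A y -> (0 <= d x y)%E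
    & exists2 s : R, 1 <= s &
      [/\ forall x y, A x -> A y -> (d x y = 0%E <-> x = y),
          forall x y, A x -> A y -> d x y = d y x
        & forall x y z, A x -> A y -> A z ->
            (d x y <= d x z + s%:E * d y z)%E]].

Definition strong_b_metric (R : realType) (T : Type)
    (A : set T) (d : T -> T -> \bar R) : Prop :=
  gen_strong_b_metric A d /\ (forall x y, A x -> A y -> (d x y < +oo)%E).

Definition sb_ball (R : realType) (T : Type)
    (A : set T) (d : T -> T -> \bar R) (x : T) (r : R) : set T :=
  [set y | A y /\ (d x y < r%:E)%E].

Definition sb_open (R : realType) (T : Type)
    (A : set T) (d : T -> T -> \bar R) (G : set T) : Prop :=
  G `<=` A /\
  (forall x, G x -> exists2 r : R, 0 < r & sb_ball A d x r `<=` G).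

Definition sb_dense (R : realType) (T : Type)
    (A : set T) (d : T -> T -> \bar R) (S : set T) : Prop :=
  S `<=` A /\
  (forall G : set T, G !=set0 -> sb_open A d G -> G `&` S !=set0).

Definition sb_cvg (R : realType) (T : Type)
    (d : T -> T -> \bar R) (u : nat -> T) (x : T) : Prop :=
  d (u n) x @[n --> \oo] --> 0%E.

Definition sb_cauchy (R : realType) (T : Type)
    (d : T -> T -> \bar R) (u : nat -> T) : Prop :=
  d (u p.1) (u p.2) @[p --> (\oo, \oo)] --> 0%E.

Definition sb_complete (R : realType) (T : Type)
    (A : set T) (d : T -> T -> \bar R) : Prop :=
  forall u : nat -> T, (forall n, A (u n)) -> sb_cauchy d u ->
    exists2 x, A x & sb_cvg d u x.

Definition isometric_embedding (R : realType) (T1 T2 : Type)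
    (A1 : set T1) (d1 : T1 -> T1 -> \bar R)
    (A2 : set T2) (d2 : T2 -> T2 -> \bar R) (f : T1 -> T2) : Prop :=
  set_fun A1 A2 f /\
  (forall x y, A1 x -> A1 y -> d2 (f x) (f y) = d1 x y).

Definition isometric (R : realType) (T1 T2 : Type)
    (A1 : set T1) (d1 : T1 -> T1 -> \bar R)
    (A2 : set T2) (d2 : T2 -> T2 -> \bar R) : Prop :=
  exists2 f : T1 -> T2, isometric_embedding A1 d1 A2 d2 f & set_surj A1 A2 f.

(* [(B, rho)], with the embedding [j], is a completion of [(A, d)]. *)
Definition sb_completion (R : realType) (T1 T2 : Type)
    (A : set T1) (d : T1 -> T1 -> \bar R)
    (B : set T2) (rho : T2 -> T2 -> \bar R) (j : T1 -> T2) : Prop :=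
  [/\ strong_b_metric B rho, sb_complete B rho,
      isometric_embedding A d B rho j & sb_dense B rho (j @` A)].

Definition finite_class (R : realType) (T : Type)
    (A : set T) (d : T -> T -> \bar R) (x : T) : set T :=
  [set y | A y /\ (d x y < +oo)%E].

(* The family [As] enumerates, without repetition, the equivalence classes of
   the relation [d x y < +oo] on [A]. *)
Definition canonical_decomposition (R : realType) (T I : Type)
    (A : set T) (d : T -> T -> \bar R) (As : I -> set T) : Prop :=
  injective As /\ range As = [set finite_class A d x | x in A].

(* Main.v *)
(* Points of two different pieces [Ys i] are at infinite distance, so a Cauchy
   sequence of [Y] eventually stays in one piece, and completeness and density
   are inherited from the pieces.  The completions [Ys i] may come with unbounded
   constants [s_i], but by continuity of the distance the constant [s] of [X]
   passes to each [Ys i], hence to [Y].  For uniqueness, relate [z] in [Z] to [y]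
   in [Y] when both are limits of images of the same points of [X]: this relation
   preserves distances and, by completeness and density, is total on both sides,
   so it is the graph of a surjective isometric embedding. *)

Require Import Defs.
From HB Require Import structures.
From mathcomp Require Import all_boot all_order all_algebra.
From mathcomp Require Import all_classical all_reals all_analysis.
From mathcomp Require Import ring.

Set Implicit Arguments.
Unset Strict Implicit.
Unset Printing Implicit Defensive.

Import Order.TTheory GRing.Theory Num.Theory.
Import numFieldNormedType.Exports.

Local Open Scope classical_set_scope.
Local Open Scope ring_scope.

(** * Epsilon forms of the topological notions, and continuity of the distance *)

Section GeneralizedStrongBMetric.
Context {R : realType}.
Implicit Types (T : Type) (s e r : R).

(** The constant is a parameter, so that the one of [X] can be followed into the pieces and into the
    glued space. *)
Definition strong_b_metric_const T s (A : set T) (d : T -> T -> \bar R) : Prop :=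
  [/\ 1 <= s,
      forall x y, A x -> A y -> (0 <= d x y)%E,
      forall x y, A x -> A y -> (d x y = 0%E <-> x = y),
      forall x y, A x -> A y -> d x y = d y x
    & forall x y z, A x -> A y -> A z -> (d x y <= d x z + s%:E * d y z)%E].

Lemma gen_strong_b_metricP T (A : set T) (d : T -> T -> \bar R) :
  gen_strong_b_metric A d <->
  A !=set0 /\ exists s, strong_b_metric_const s A d.
Proof.
split=> [[A0 d_ge0 [s s1 [d0 dC dD]]]|[A0 [s [s1 d_ge0 d0 dC dD]]]].
  by split=> //; exists s.
by split=> //; exists s.
Qed.

Lemma ge0_cvge0P T (F : set_system T) (f : T -> \bar R) : Filter F ->
  (forall x, 0 <= f x)%E ->
  f x @[x --> F] --> 0%E <->
  forall e, 0 < e -> \forall x \near F, (f x < e%:E)%E.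
Proof.
move=> FF f_ge0; split=> [f0 e e0|f0 A].
  apply: (f0 [set y | (y < e%:E)%E]).
  rewrite /nbhs /= /ereal_nbhs /=; exists e => //= y /=.
  by rewrite sub0r normrN lte_fin; apply: le_lt_trans; exact: ler_norm.
rewrite /nbhs /= /ereal_nbhs /= => -[e /= e0 eA].
apply: filterS (f0 e e0) => x fxe.
have := f_ge0 x; rewrite /preimage /=; case: (f x) fxe => [y| |] //; rewrite lte_fin lee_fin => ye y0.
by apply: eA; rewrite /= sub0r normrN ger0_norm.
Qed.

Lemma sb_cvgP T (d : T -> T -> \bar R) (u : nat -> T) x :
  (forall n, 0 <= d (u n) x)%E ->
  sb_cvg d u x <->
  forall e, 0 < e -> exists N, forall n, (N <= n)%N -> (d (u n) x < e%:E)%E.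
Proof.
move=> d_ge0; rewrite /sb_cvg ge0_cvge0P //.
by split=> H e e0; have [N] := H e e0; [move=> _|]; exists N.
Qed.

Lemma sb_cauchyP T (d : T -> T -> \bar R) (u : nat -> T) :
  (forall m n, 0 <= d (u m) (u n))%E ->
  sb_cauchy d u <->
  forall e, 0 < e -> exists N, forall m n, (N <= m)%N -> (N <= n)%N ->
    (d (u m) (u n) < e%:E)%E.
Proof.
move=> d_ge0; rewrite /sb_cauchy ge0_cvge0P //.
split=> H e /H.
  move=> [[P Q] /= [[M _ MP] [N _ NQ]] PQ]; exists (maxn M N) => m n.
  rewrite !geq_max => /andP[Mm _] /andP[_ Nn].
  by apply: (PQ (m, n)); split; [exact: MP|exact: NQ].
move=> [N HN]; exists ([set n | (N <= n)%N], [set n | (N <= n)%N]) => /=.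
  by split; exists N.
by move=> [m n] [/= Nm Nn]; exact: HN.
Qed.

(** Balls are open sets, because one term of the triangle inequality carries the coefficient 1;
    density is then applied to the ball around [x]. *)
Lemma sb_dense_approx T s (A S : set T) (d : T -> T -> \bar R) :
  strong_b_metric_const s A d -> sb_dense A d S ->
  forall x e, A x -> 0 < e -> exists y, [/\ S y, A y & (d x y < e%:E)%E].
Proof.
move=> [s1 d_ge0 d0 dC dD] [SA Sd] x e Ax e0.
have s0 : 0 < s by exact: lt_le_trans s1.
have [||y [[Ay yx] Sy]] := Sd (sb_ball A d x e); last by exists y.
- by exists x; split=> //; rewrite (d0 x x Ax Ax).2.
- split=> [y []//|y [Ay dxy]].
  have [a dxyE] : exists a, d x y = a%:E.
    by have := d_ge0 _ _ Ax Ay; case: (d x y) dxy => // a _ _; exists a.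
  move: dxy; rewrite dxyE lte_fin => ae.
  (* With [a = d x y], this radius gives [d x z <= a + s * d y z < e]. *)
  exists ((e - a) / s); first by rewrite divr_gt0 // subr_gt0.
  move=> z [Az dyz]; split=> //.
  apply: le_lt_trans (dD _ _ _ Ax Az Ay) _.
  rewrite dxyE (dC _ _ Az Ay).
  have := d_ge0 _ _ Ay Az; case: (d y z) dyz => // b.
  by rewrite lte_fin -EFinM -EFinD lte_fin ltr_pdivlMr // ltrBrDl mulrC.
Qed.

Lemma sb_dense_of_approx T (A S : set T) (d : T -> T -> \bar R) :
  S `<=` A ->
  (forall x e, A x -> 0 < e -> exists2 y, S y & (d x y < e%:E)%E) ->
  sb_dense A d S.
Proof.
move=> SA Sd; split=> // G [x Gx] [GA Gop].
have [e e0 eG] := Gop x Gx; have [y Sy xy] := Sd x e (GA _ Gx) e0.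
by exists y; split=> //; apply: eG; split=> //; exact: SA.
Qed.

(** The endpoints are moved one at a time, with the triangle inequality oriented so that [s]
    multiplies only the displacement; each move costs at most [s * e]. *)
Lemma strong_b_metric_perturb T s (A : set T) (d : T -> T -> \bar R) :
  strong_b_metric_const s A d ->
  forall x y x' y' e, A x -> A y -> A x' -> A y' ->
    (d x x' < e%:E)%E -> (d y y' < e%:E)%E ->
    (d x y <= d x' y' + (s * (e + e))%:E)%E.
Proof.
move=> [s1 d_ge0 d0 dC dD] x y x' y' e Ax Ay Ax' Ay' xx' yy'.
have s0 : 0 <= s by exact: le_trans s1.
have sd p q : (d p q < e%:E -> s%:E * d p q <= (s * e)%:E)%E.
  by move=> pq; rewrite EFinM; apply: lee_wpmul2l; [rewrite lee_fin|exact: ltW].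
apply: le_trans (dD _ _ _ Ax Ay Ay') _.
rewrite mulrDr EFinD addeA; apply: leeD (sd _ _ yy').
rewrite (dC _ _ Ax Ay') (dC _ _ Ax' Ay').
apply: le_trans (dD _ _ _ Ay' Ax Ax') _.
by apply: leeD => //; exact: sd.
Qed.

Lemma lee_addgt0_mulP r (a b : \bar R) : 0 <= r ->
  (forall e, 0 < e -> (a <= b + (r * e)%:E)%E) -> (a <= b)%E.
Proof.
move=> r0 H; apply/lee_addgt0Pr => e e0.
(* Dividing by [r + 1] rather than [r] covers the case [r = 0]. *)
have r10 : 0 < r + 1 by rewrite ltr_wpDl.
apply: le_trans (H (e / (r + 1)) _) _; first exact: divr_gt0.
apply: leeD => //; rewrite lee_fin mulrCA ler_piMr ?(ltW e0) //.
by rewrite ler_pdivrMr // mul1r lerDl.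
Qed.

(* The constant [s] of the dense part is inherited by the whole space, whose own
   constant [t] only serves for the continuity of [d]. *)
Lemma strong_b_metric_const_dense T s t (A S : set T) (d : T -> T -> \bar R) :
  0 <= s -> strong_b_metric_const t A d -> sb_dense A d S ->
  (forall x y z, S x -> S y -> S z -> (d x y <= d x z + s%:E * d y z)%E) ->
  forall x y z, A x -> A y -> A z -> (d x y <= d x z + s%:E * d y z)%E.
Proof.
move=> s0 dA Sd dS x y z Ax Ay Az.
have approx := sb_dense_approx dA Sd.
have perturb := strong_b_metric_perturb dA.
have [t1 d_ge0 d0 dC dD] := dA.
have t0 : 0 <= t by exact: le_trans t1.
(* Approximating the three points costs [t * (e + e)] for each of the three distances; the one of
   [d y z] is multiplied by [s], whence the total [t * 2 * (2 + s) * e]. *)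
apply: (@lee_addgt0_mulP (t * 2 * (2 + s))).
  by rewrite !mulr_ge0 // addr_ge0.
move=> e e0.
have [x' [Sx' Ax' xx']] := approx x e Ax e0.
have [y' [Sy' Ay' yy']] := approx y e Ay e0.
have [z' [Sz' Az' zz']] := approx z e Az e0.
apply: le_trans (perturb _ _ _ _ _ Ax Ay Ax' Ay' xx' yy') _.
have -> : t * 2 * (2 + s) * e =
    t * (e + e) + s * (t * (e + e)) + t * (e + e) by ring.
rewrite !EFinD !addeA; apply: leeD => //.
apply: le_trans (dS _ _ _ Sx' Sy' Sz') _.
have sM : (s%:E * d y' z' <= s%:E * d y z + (s * (t * (e + e)))%:E)%E.
  have te0 : (0 <= (t * (e + e))%:E)%E.
    by rewrite lee_fin mulr_ge0 // addr_ge0 // ltW.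
  rewrite [in leRHS]EFinM -ge0_muleDr ?d_ge0 //.
  apply: lee_wpmul2l; first by rewrite lee_fin.
  by apply: perturb => //; rewrite dC.
apply: (@le_trans _ _ ((d x z + (t * (e + e))%:E) +
    (s%:E * d y z + (s * (t * (e + e)))%:E))%E).
  by apply: leeD => //; apply: perturb => //; rewrite dC.
by rewrite addeACA addeA.
Qed.

End GeneralizedStrongBMetric.

(** * Uniqueness of a complete space with a dense isometric copy of [X] *)

Section DenseIsometricCopies.
Context {R : realType} {U : Type} (X : set U) (d : U -> U -> \bar R).

(* [z] and [y] are limits of one and the same net of points of [X]. *)
Definition same_limit {W V : Type} (rho : W -> W -> \bar R) (S : U -> W)
    (D : V -> V -> \bar R) (T : U -> V) (z : W) (y : V) : Prop :=
  forall e : R, 0 < e ->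
    exists x, [/\ X x, (rho z (S x) < e%:E)%E & (D y (T x) < e%:E)%E].

Lemma same_limitC {W V : Type} (rho : W -> W -> \bar R) (S : U -> W)
    (D : V -> V -> \bar R) (T : U -> V) z y :
  same_limit rho S D T z y -> same_limit D T rho S y z.
Proof. by move=> zy e /zy[x [? ? ?]]; exists x. Qed.

(** Both distances are compared with [d x x'] for common approximants [x] and [x'], which [S] and
    [T] preserve. The reverse inequality comes from exchanging the two spaces. *)
Lemma same_limit_le {W V : Type} (Z : set W) (rho : W -> W -> \bar R)
    (S : U -> W) (Y : set V) (D : V -> V -> \bar R) (T : U -> V) (s t : R) :
  strong_b_metric_const s Z rho -> isometric_embedding X d Z rho S ->
  strong_b_metric_const t Y D -> isometric_embedding X d Y D T ->
  forall z z' y y', Z z -> Z z' -> Y y -> Y y' ->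
    same_limit rho S D T z y -> same_limit rho S D T z' y' ->
    (rho z z' <= D y y')%E.
Proof.
move=> hZ [SZ Sd] hY [TY Td] z z' y y' Zz Zz' Yy Yy' zy zy'.
have [s1 _ _ _ _] := hZ; have [t1 _ _ DC _] := hY.
have s0 : 0 <= s by exact: le_trans s1.
have t0 : 0 <= t by exact: le_trans t1.
apply: (@lee_addgt0_mulP _ (2 * (t + s))); first by rewrite mulr_ge0 ?addr_ge0.
move=> e e0; have [x [Xx zx yx]] := zy e e0; have [x' [Xx' zx' yx']] := zy' e e0.
have ZS w : X w -> Z (S w) by exact: SZ.
have YT w : X w -> Y (T w) by exact: TY.
apply: le_trans
  (strong_b_metric_perturb hZ Zz Zz' (ZS _ Xx) (ZS _ Xx') zx zx') _.
have -> : 2 * (t + s) * e = t * (e + e) + s * (e + e) by ring.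
rewrite EFinD addeA; apply: leeD => //; rewrite Sd // -Td //.
by apply: (strong_b_metric_perturb hY) => //; try (exact: YT);
  rewrite DC //; exact: YT.
Qed.

(** Points [u n] of [X] with [S (u n)] within [1/(n+1)] of [z] have Cauchy images under [S], hence
    under [T]; completeness of [Y] yields the limit [y]. *)
Lemma same_limit_exists {W V : Type} (Z : set W) (rho : W -> W -> \bar R)
    (S : U -> W) (Y : set V) (D : V -> V -> \bar R) (T : U -> V) (s t : R) :
  strong_b_metric_const s Z rho -> isometric_embedding X d Z rho S ->
  sb_dense Z rho (S @` X) ->
  strong_b_metric_const t Y D -> isometric_embedding X d Y D T ->
  sb_complete Y D ->
  forall z, Z z -> exists2 y, Y y & same_limit rho S D T z y.
Proof.
move=> hZ [SZ Sd] dnZ hY [TY Td] cY z Zz.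
have [s1 rho_ge0 _ rhoC rhoD] := hZ; have [t1 D_ge0 _ DC _] := hY.
have s0 : 0 <= s by exact: le_trans s1.
have approx n : exists x, X x /\ (rho z (S x) < (n.+1%:R^-1 : R)%:E)%E.
  have n0 : 0 < n.+1%:R^-1 :> R by rewrite invr_gt0.
  by have [_ [[x Xx <-] _ zx]] := sb_dense_approx hZ dnZ Zz n0; exists x.
have [u hu] := choice approx.
have Xu n : X (u n) := (hu n).1.
have YTu n : Y (T (u n)) by exact: TY.
have ZSu n : Z (S (u n)) by exact: SZ.
have small e : 0 < e -> exists N, forall n, (N <= n)%N ->
    (rho z (S (u n)) < e%:E)%E.
  move=> e0; have [N _ HN] := near_infty_natSinv_lt (PosNum e0).
  exists N => n Nn; apply: lt_trans (hu n).2 _; rewrite lte_fin; exact: HN.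
have cau : sb_cauchy D (T \o u).
  apply/sb_cauchyP => [m n|e e0]; first by apply: D_ge0; exact: YTu.
  (* Going through [z] costs one distance with coefficient 1 and one with coefficient [s]. *)
  have e'0 : 0 < e / (1 + s) by rewrite divr_gt0 // ltr_pwDl.
  have [N HN] := small _ e'0; exists N => m n Nm Nn /=.
  rewrite Td // -Sd //.
  apply: le_lt_trans (rhoD _ _ _ (ZSu m) (ZSu n) Zz) _.
  rewrite (rhoC _ _ (ZSu m) Zz) (rhoC _ _ (ZSu n) Zz).
  have -> : e = e / (1 + s) + s * (e / (1 + s)).
    by rewrite -{1}[e / _]mul1r -mulrDl mulrC divfK // gt_eqF // ltr_pwDl.
  rewrite EFinD (EFinM s); apply: lteD; first exact: HN.
  by rewrite lte_pmul2l ?lte_fin ?(lt_le_trans _ s1) //; exact: HN.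
have [y Yy] := cY _ YTu cau.
move=> /(sb_cvgP (fun n => D_ge0 _ _ (YTu n) Yy)) uy.
exists y => // e e0.
have [N HN] := small e e0; have [M HM] := uy e e0.
exists (u (maxn N M)); split=> //; first by apply: HN; rewrite leq_maxl.
by rewrite DC //; apply: HM; rewrite leq_maxr.
Qed.

Lemma complete_dense_copies_isometric {W V : Type}
    (Z : set W) (rho : W -> W -> \bar R) (S : U -> W)
    (Y : set V) (D : V -> V -> \bar R) (T : U -> V) :
  gen_strong_b_metric Z rho -> sb_complete Z rho ->
  isometric_embedding X d Z rho S -> sb_dense Z rho (S @` X) ->
  gen_strong_b_metric Y D -> sb_complete Y D ->
  isometric_embedding X d Y D T -> sb_dense Y D (T @` X) ->
  isometric Z rho Y D.
Proof.
move=> /gen_strong_b_metricP[_ [s hZ]] cZ iS dnZ.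
move=> /gen_strong_b_metricP[[y0 Yy0] [t hY]] cY iT dnY.
(* [choice] needs a value at every [z] of the ambient type; outside [Z] it is the dummy [y0]. *)
have exlim z : exists y, Z z -> Y y /\ same_limit rho S D T z y.
  have [Zz|nZz] := pselect (Z z); last by exists y0.
  by have [y] := same_limit_exists hZ iS dnZ hY iT cY Zz; exists y.
have [f fP] := choice exlim.
have eqd z z' y y' : Z z -> Z z' -> Y y -> Y y' ->
    same_limit rho S D T z y -> same_limit rho S D T z' y' ->
    D y y' = rho z z'.
  move=> Zz Zz' Yy Yy' zy zy'; apply/eqP; rewrite eq_le; apply/andP; split.
    by apply: (same_limit_le hY iT hZ iS) => //; exact: same_limitC.
  exact: (same_limit_le hZ iS hY iT).
exists f.
  split=> [z /fP[]//|z z' Zz Zz'].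
  by have [? ?] := fP _ Zz; have [? ?] := fP _ Zz'; exact: eqd.
move=> y Yy; have [z Zz yz] := same_limit_exists hY iT dnY hZ iS cZ Yy.
have zy := same_limitC yz.
exists z => //; have [Yfz zfz] := fP _ Zz.
have [_ _ D0 _ _] := hY; have [_ _ rho0 _ _] := hZ.
(* Both [f z] and [y] share limits with [z], so [D (f z) y = rho z z = 0]. *)
by apply/(D0 _ _ Yfz Yy); rewrite (eqd z z) //; apply/rho0.
Qed.

End DenseIsometricCopies.

(** * Classes of points at finite distance *)

Lemma canonical_decomposition_cover {R : realType} {U I : Type} (X : set U)
    (d : U -> U -> \bar R) (Xs : I -> set U) :
  gen_strong_b_metric X d -> canonical_decomposition X d Xs ->
  forall x, X x -> exists i, Xs i x.
Proof.
move=> [_ _ [s _ [d0 _ _]]] [_ rg] x Xx.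
have : [set finite_class X d x | x in X] (finite_class X d x) by exists x.
rewrite -rg => -[i _ Xsi]; exists i; rewrite Xsi; split=> //.
by rewrite (d0 x x Xx Xx).2.
Qed.

(** Finiteness of the distance is symmetric and transitive, so any member of a class can replace the
    centre [c] from which the class was defined. *)
Lemma canonical_decompositionP {R : realType} {U I : Type} (X : set U)
    (d : U -> U -> \bar R) (Xs : I -> set U) :
  gen_strong_b_metric X d -> canonical_decomposition X d Xs ->
  forall i x y, Xs i x -> Xs i y <-> X y /\ (d x y < +oo)%E.
Proof.
move=> [_ d_ge0 [s s1 [d0 dC dD]]] [_ rg] i x y.
have fin_trans a b c : X a -> X b -> X c -> (d a c < +oo -> d b c < +oo ->
    d a b < +oo)%E.
  move=> Xa Xb Xc ac bc; apply: le_lt_trans (dD a b c Xa Xb Xc) _.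
  apply: lte_add_pinfty => //; apply: lte_mul_pinfty => //.
  by rewrite lee_fin (le_trans _ s1).
have [c Xc <-] : [set finite_class X d x | x in X] (Xs i).
  by rewrite -rg; exists i.
move=> [Xx cx]; split=> [[Xy cy]|[Xy xy]]; split=> //.
  by apply: (fin_trans _ _ c) => //; rewrite dC.
by apply: (fin_trans _ _ x) => //; rewrite dC.
Qed.

(** * Gluing the completions of the classes *)

Theorem theorem2p4 (R : realType) (U V I : Type)
    (X : set U) (d : U -> U -> \bar R) (Xs : I -> set U)
    (Ys : I -> set V) (Ds : I -> V -> V -> \bar R) (Ts : I -> U -> V)
    (D : V -> V -> \bar R) (T : U -> V)
    (hX : gen_strong_b_metric X d)
    (hXs : canonical_decomposition X d Xs)
    (hYs : forall i, sb_completion (Xs i) d (Ys i) (Ds i) (Ts i))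
    (hdisj : trivIset [set: I] Ys)
    (hDin : forall i x y, Ys i x -> Ys i y -> D x y = Ds i x y)
    (hDout : forall i j x y, i <> j -> Ys i x -> Ys j y -> D x y = +oo%E)
    (hT : forall i x, Xs i x -> T x = Ts i x) :
  let Y := \bigcup_(i in [set: I]) Ys i in
  [/\ gen_strong_b_metric Y D /\ sb_complete Y D,
      isometric_embedding X d Y D T /\ sb_dense Y D (T @` X)
    & forall (W : Type) (Z : set W) (rho : W -> W -> \bar R),
        gen_strong_b_metric Z rho -> sb_complete Z rho ->
        (exists2 S : U -> W,
           isometric_embedding X d Z rho S & sb_dense Z rho (S @` X)) ->
        isometric Z rho Y D].
Proof.
move=> Y.
have [[x0 Xx0] d_ge0 [s s1 [d0 dC dD]]] := hX.
have s0 : 0 <= s by exact: le_trans s1.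
have cover := canonical_decomposition_cover hX hXs.
have classP := canonical_decompositionP hX hXs.
have XsX i x : Xs i x -> X x by move=> ix; exact: ((classP _ _ _ ix).1 ix).1.
have sameY i j y : Ys i y -> Ys j y -> i = j.
  by move=> iy jy; apply: hdisj => //; exists y.
have TY i x : Xs i x -> Ys i (T x).
  by move=> ix; rewrite (hT _ _ ix); have [_ _ [TsY _] _] := hYs i; exact: TsY.
(* The constant [t] obtained here depends on [i] and need not be bounded over [I]. *)
have metricYs i : exists t, strong_b_metric_const t (Ys i) D.
  have [[+ _] _ _ _] := hYs i.
  move=> /gen_strong_b_metricP[_ [t [t1 D_ge0 D0 DC DD]]]; exists t.
  split=> // *; rewrite !(hDin i) //; [exact: D_ge0|exact: D0|exact: DC|exact: DD].
have denseYs i : sb_dense (Ys i) D (T @` Xs i).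
  have [[+ _] _ _ dn] := hYs i; move=> /gen_strong_b_metricP[_ [t hY]].
  apply: sb_dense_of_approx => [_ [x ix <-]|y e iy e0]; first exact: TY.
  have [_ [[x ix <-] ? ?]] := sb_dense_approx hY dn iy e0.
  by exists (T x); [exists x|rewrite (hT _ _ ix) (hDin i)].
have isoT : isometric_embedding X d Y D T.
  split=> [x /cover[i ix]|x y Xx Xy]; first by exists i => //; exact: TY.
  have [i ix] := cover _ Xx; have [j jy] := cover _ Xy.
  have [ij|ij] := pselect (i = j).
    move: jy; rewrite -ij => iy; rewrite (hDin i); [|exact: TY|exact: TY].
    by have [_ _ [_ Tsd] _] := hYs i; rewrite !(hT i) // Tsd.
  rewrite (hDout _ _ _ _ ij (TY _ _ ix) (TY _ _ jy)).
  (* If [d x y] were finite, [Xs i] and [Xs j] would be the same class, and [Xs] is injective. *)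
  apply/esym/eqP; rewrite -leye_eq leNgt; apply/negP => xy.
  have iy : Xs i y by exact/(classP _ _ _ ix).
  apply: ij; apply: hXs.1; apply/seteqP; split=> z zi.
    by apply/(classP _ _ _ jy); apply/(classP _ _ _ iy).
  by apply/(classP _ _ _ iy); apply/(classP _ _ _ jy).
have D_ge0 x y : Y x -> Y y -> (0 <= D x y)%E.
  move=> [i _ ix] [j _ jy]; have [ij|ij] := pselect (i = j).
    by move: jy; rewrite -ij => iy; have [t [_ + _ _ _]] := metricYs i; exact.
  by rewrite (hDout _ _ _ _ ij ix jy).
have metricY : strong_b_metric_const s Y D.
  split=> //.
  - move=> x y [i _ ix] [j _ jy]; have [ij|ij] := pselect (i = j).
      by move: jy; rewrite -ij => iy; have [t [_ _ + _ _]] := metricYs i; exact.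
    rewrite (hDout _ _ _ _ ij ix jy); split=> // xy.
    by case: ij; apply: sameY ix _; rewrite xy.
  - move=> x y [i _ ix] [j _ jy]; have [ij|ij] := pselect (i = j).
      by move: jy; rewrite -ij => iy; have [t [_ _ _ + _]] := metricYs i; exact.
    by rewrite (hDout _ _ _ _ ij ix jy) (hDout _ _ _ _ (nesym ij) jy ix).
  - move=> x y z Yx Yy Yz.
    have sD_ge0 : (0 <= s%:E * D y z)%E by rewrite mule_ge0 ?D_ge0.
    have [i _ ix] := Yx; have [j _ jy] := Yy; have [k _ kz] := Yz.
    (* If [z] lies in another piece than [x] or [y], the right-hand side is [+oo]. *)
    have [ik|ik] := pselect (i = k); last first.
      rewrite (hDout _ _ _ _ ik ix kz) addye ?leey // gt_eqF //.
      exact: lt_le_trans sD_ge0.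
    have [jk|jk] := pselect (j = k); last first.
      rewrite (hDout _ _ _ _ jk jy kz) gt0_muley ?lte_fin ?(lt_le_trans _ s1) //.
      by rewrite addey ?leey // gt_eqF // (lt_le_trans _ (D_ge0 _ _ Yx Yz)).
    move: ix jy; rewrite ik jk => kx ky.
    have [t hY] := metricYs k.
    (* Within one piece, the inequality with constant [s] holds on the dense image of [Xs k], where
       [D] is a copy of [d], and extends by continuity. *)
    apply: (strong_b_metric_const_dense s0 hY (denseYs k)) => //.
    move=> _ _ _ [x' kx' <-] [y' ky' <-] [z' kz' <-].
    by rewrite !isoT.2 //; try exact: (XsX k); apply: dD; exact: (XsX k).
have gsbY : gen_strong_b_metric Y D.
  apply/gen_strong_b_metricP; split; last by exists s.
  by exists (T x0); exact: isoT.1.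
have completeY : sb_complete Y D.
  move=> u Yu /(sb_cauchyP (fun m n => D_ge0 _ _ (Yu m) (Yu n))) cu.
  (* Any finite bound would do in place of 1: it forces all terms from [N] on into the piece of
     [u N]. Completeness of that piece is applied to the sequence shifted by [N]. *)
  have [N uN] := cu 1 ltr01; have [i _ iN] := Yu N.
  have iu n : Ys i (u (N + n)%N).
    have [j _ jn] := Yu (N + n)%N.
    have [->//|ij] := pselect (i = j).
    have := uN N (N + n)%N (leqnn _) (leq_addr _ _).
    by rewrite (hDout _ _ _ _ ij iN jn).
  have [_ ci _ _] := hYs i.
  have [t [_ Di_ge0 _ _ _]] := metricYs i.
  have [|x ix] := ci _ iu.
    apply/sb_cauchyP => [m n|e /cu[M uM]]; first by rewrite -(hDin i) ?Di_ge0.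
    exists M => m n Mm Mn; rewrite -(hDin i) //.
    by apply: uM; rewrite (leq_trans _ (leq_addl _ _)).
  have Yx : Y x by exists i.
  move=> /sb_cvgP ux; exists x => //.
  apply/sb_cvgP => [n|e e0]; first exact: D_ge0.
  have [n|M uM] := ux _ e e0; first by rewrite -(hDin i) ?Di_ge0.
  exists (N + M)%N => n NMn.
  have Nn : (N <= n)%N by rewrite (leq_trans _ NMn) ?leq_addr.
  rewrite -(subnKC Nn) (hDin i) //; apply: uM.
  by rewrite leq_subRL.
have denseY : sb_dense Y D (T @` X).
  apply: sb_dense_of_approx => [_ [x Xx <-]|y e [i _ iy] e0]; first exact: isoT.1.
  have [t hY] := metricYs i.
  have [_ [[x ix <-] _ yx]] := sb_dense_approx hY (denseYs i) iy e0.
  by exists (T x) => //; exists x => //; exact: (XsX i).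
split=> // W Z rho gsbZ completeZ [S isoS denseZ].
exact: (complete_dense_copies_isometric gsbZ completeZ isoS denseZ gsbY completeY
  isoT denseY).
Qed.
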